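(* For all integers $k\ge n\ge 0$, the following inequalities hold: $$2\cdot d_{\mathrm{GH}}(S^n,S^k)\;\ge\;\inf\{\operatorname{dis}(f)\mid f\colon S^k\to S^n \text{ is an odd function}\}\;\ge\; c_{n,k},$$ where $c_{n,k}=\inf\{r\ge 0\mid \text{there exists an odd map } S^k\to \mathrm{VR}(S^n;r)\}$.
   Context: $S^n=\{x\in\mathbb{R}^{n+1}\mid \|x\|=1\}$ carries the geodesic metric $d_{S^n}(x,x')=\arccos\langle x,x'\rangle$ (so $S^0$ has diameter $\pi$), with involution $x\mapsto -x$. A ''function'' may be discontinuous; a ''map'' is a continuous function. A function between spaces with involutions (both written $x\mapsto -x$) is odd if $f(-x)=-f(x)$ for all $x$. For a metric space $X$ and $r\ge 0$, the Vietoris--Rips complex $\mathrm{VR}(X;r)$ is the simplicial complex with vertex set $X$ whose simplices are the nonempty finite subsets $\sigma\subseteq X$ with $\operatorname{diam}(\sigma)\le r$; it is identified with its geometric realization (points are $\sum_i\lambda_i x_i$ with $\lambda_i\ge0$, $\sum_i\lambda_i=1$). If $X$ has an isometric involution $x\mapsto -x$, then $\mathrm{VR}(X;r)$ has the involution $-\left(\sum_i\lambda_i x_i\right)=\sum_i\lambda_i(-x_i)$. The distortion of a function $f\colon X\to Y$ between bounded metric spaces is $\operatorname{dis}(f)=\sup_{x,x'\in X}|d_X(x,x')-d_Y(f(x),f(x'))|$. The Gromov--Hausdorff distance $d_{\mathrm{GH}}(X,Y)$ of bounded metric spaces is the infimum, over all metric spaces $Z$ and isometric embeddings $\gamma\colon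 X\to Z$, $\varphi\colon Y\to Z$, of the Hausdorff distance in $Z$ between $\gamma(X)$ and $\varphi(Y)$. Equivalently, $2\,d_{\mathrm{GH}}(X,Y)=\inf_R \sup_{(x,y),(x',y')\in R}|d_X(x,x')-d_Y(y,y')|$, where $R\subseteq X\times Y$ ranges over all relations whose projections to $X$ and to $Y$ are surjective. *)

(* Defs.v *)
From HB Require Import structures.
From mathcomp Require Import all_boot all_order all_algebra.
From mathcomp Require Import all_classical all_reals all_analysis.
From mathcomp Require Import ring.

Set Implicit Arguments.
Unset Strict Implicit.
Unset Printing Implicit Defensive.

Import Order.TTheory GRing.Theory Num.Theory.

Local Open Scope classical_set_scope.
Local Open Scope ring_scope.

Definition dot (R : realType) (m : nat) (u v : 'rV[R]_m) : R :=
  \sum_(i < m) u 0 i * v 0 i.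

(* The Euclidean norm; the library's `|u| on row vectors is the sup norm. *)
Definition enorm (R : realType) (m : nat) (u : 'rV[R]_m) : R :=
  Num.sqrt (dot u u).

Section DotTheory.
Variables (R : realType) (m : nat).
Implicit Types u v w : 'rV[R]_m.

Lemma dotC u v : dot u v = dot v u.
Proof. by apply: eq_bigr => i _; rewrite mulrC. Qed.

Lemma dotDl u v w : dot (u + v) w = dot u w + dot v w.
Proof. by rewrite -big_split; apply: eq_bigr => i _; rewrite mxE mulrDl. Qed.

Lemma dotZl a u w : dot (a *: u) w = a * dot u w.
Proof. by rewrite mulr_sumr; apply: eq_bigr => i _; rewrite mxE mulrA. Qed.

Lemma dotNl u w : dot (- u) w = - dot u w.
Proof. by rewrite -scaleN1r dotZl mulN1r. Qed.

Lemma dotDr u v w : dot w (u + v) = dot w u + dot w v.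
Proof. by rewrite !(dotC w) dotDl. Qed.

Lemma dotZr a u w : dot w (a *: u) = a * dot w u.
Proof. by rewrite !(dotC w) dotZl. Qed.

Lemma dotNr u w : dot w (- u) = - dot w u.
Proof. by rewrite !(dotC w) dotNl. Qed.

Lemma dotvv_ge0 u : 0 <= dot u u.
Proof. by apply: sumr_ge0 => i _; rewrite -expr2 sqr_ge0. Qed.

Lemma dotvv_eq0 u : dot u u = 0 -> u = 0.
Proof.
move=> /eqP; rewrite psumr_eq0; last by move=> i _; rewrite -expr2 sqr_ge0.
move=> /allP u0; apply/rowP => i; rewrite mxE.
by apply/eqP; have := u0 i (mem_index_enum i); rewrite /= mulf_eq0 orbb.
Qed.

Lemma enormN u : enorm (- u) = enorm u.
Proof. by rewrite /enorm dotNl dotNr opprK. Qed.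

Lemma dot_CauchySchwarz u v : dot u v ^+ 2 <= dot u u * dot v v.
Proof.
have [v0|v0] := eqVneq (dot v v) 0.
  rewrite (dotvv_eq0 v0) -(scale0r 0) !dotZr !mul0r mulr0 expr0n /=.
  exact: lexx.
have vgt0 : 0 < dot v v by rewrite lt_def v0 dotvv_ge0.
have := dotvv_ge0 (dot v v *: u - dot u v *: v).
rewrite dotDl !dotDr !dotNl !dotNr !dotZl !dotZr opprK (dotC v u).
rewrite (_ : _ + _ = dot v v * (dot u u * dot v v - dot u v ^+ 2)).
  by rewrite pmulr_rge0// subr_ge0.
ring.
Qed.

End DotTheory.

Record sphere (R : realType) (n : nat) := Sphere {
  sphere_val :> 'rV[R]_n.+1 ;
  sphereP : enorm sphere_val == 1
}.

HB.instance Definition _ (R : realType) (n : nat) :=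
  [isSub of sphere R n for @sphere_val R n].
HB.instance Definition _ (R : realType) (n : nat) :=
  [Choice of sphere R n by <:].

Definition sphere_dist (R : realType) (n : nat) (x y : sphere R n) : R :=
  acos (dot x y).

Section SphereTheory.
Variables (R : realType) (n : nat).
Implicit Types x y z : sphere R n.

Lemma sphere_dot x : dot x x = 1.
Proof.
have /eqP e1 := sphereP x.
by rewrite -[LHS]sqr_sqrtr ?dotvv_ge0// -/(enorm x) e1 expr1n.
Qed.

Lemma sphere_dotB x y : -1 <= dot x y <= 1.
Proof.
rewrite -ler_norml -[leRHS]normr1 -ler_sqr ?nnegrE ?normr_ge0//.
rewrite !real_normK ?num_real//.
by rewrite (le_trans (dot_CauchySchwarz _ _))// !sphere_dot mulr1 expr1n.
Qed.

Lemma sphere_distxx x : sphere_dist x x = 0.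
Proof. by rewrite /sphere_dist sphere_dot acos1. Qed.

Lemma sphere_dist_sym x y : sphere_dist x y = sphere_dist y x.
Proof. by rewrite /sphere_dist dotC. Qed.

Lemma sphere_dist_positivity x y : sphere_dist x y = 0 -> x = y.
Proof.
move=> /(congr1 (@cos R)); rewrite cos0 acosK ?in_itv/= ?sphere_dotB// => d1.
apply/val_inj/eqP => /=; rewrite -subr_eq0; apply/eqP/dotvv_eq0.
rewrite dotDl !dotDr !dotNl !dotNr opprK !sphere_dot (dotC y x) d1.
by rewrite subrr addNr addr0.
Qed.

Lemma sphere_dist_triangle y x z :
  sphere_dist x z <= sphere_dist x y + sphere_dist y z.
Proof.
rewrite /sphere_dist; set a := dot x y; set b := dot y z; set c := dot x z.
have aB : -1 <= a <= 1 by exact: sphere_dotB.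
have bB : -1 <= b <= 1 by exact: sphere_dotB.
have cB : -1 <= c <= 1 by exact: sphere_dotB.
have [piab|abpi] := lerP pi (acos a + acos b).
  by rewrite (le_trans (acos_lepi cB)).
have abI : acos a + acos b \in `[0, pi].
  by rewrite in_itv/= addr_ge0 ?acos_ge0// ltW.
rewrite leNgt -ltr_cos ?in_itv/= ?acos_ge0 ?acos_lepi// -leNgt.
rewrite cosD !acosK ?in_itv// !sin_acos// lerBlDr addrC -lerBlDr.
rewrite -sqrtrM; last first.
  rewrite subr_ge0 -[leRHS](expr1n _ 2) -real_normK ?num_real//.
  by rewrite ler_sqr ?nnegrE ?normr_ge0// ler_norml.
rewrite (le_trans (ler_norm _))// -sqrtr_sqr ler_wsqrtr//.
have dxy (u v : 'rV[R]_n.+1) (s t : R) :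
    dot (u - s *: sphere_val y) (v - t *: sphere_val y) =
    dot u v - t * dot u y - s * dot v y + s * t.
  rewrite dotDl !dotDr !dotNl !dotNr !dotZl !dotZr sphere_dot mulr1 opprK.
  by rewrite (dotC y v); ring.
have := @dot_CauchySchwarz R n.+1
  (sphere_val x - a *: sphere_val y) (sphere_val z - b *: sphere_val y).
rewrite !dxy !sphere_dot (dotC z y) -/a -/b -/c.
rewrite (_ : (_ - _ + _) ^+ 2 = (a * b - c) ^+ 2); last by ring.
by rewrite (_ : (_ + _) * _ = (1 - a ^+ 2) * (1 - b ^+ 2)); last by ring.
Qed.

End SphereTheory.

HB.instance Definition _ (R : realType) (n : nat) :=
  @isMetric.Build R (sphere R n) (@sphere_dist R n) (@sphere_distxx R n)
    (@sphere_dist_positivity R n) (@sphere_dist_sym R n)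
    (@sphere_dist_triangle R n).

Lemma sphere_opp_subproof (R : realType) (n : nat) (x : sphere R n) :
  enorm (- sphere_val x) == 1.
Proof. by rewrite enormN sphereP. Qed.

Definition sphere_opp (R : realType) (n : nat) (x : sphere R n) :
    sphere R n :=
  Sphere (sphere_opp_subproof x).

Lemma sphere_oppK (R : realType) (n : nat) : involutive (@sphere_opp R n).
Proof. by move=> x; apply/val_inj; rewrite /= opprK. Qed.

Definition isometric_embedding (R : realType) (X Y : metricType R)
    (f : X -> Y) : Prop :=
  forall x x' : X, mdist (f x) (f x') = mdist x x'.

Lemma sphere_opp_isometry (R : realType) (n : nat) :
  isometric_embedding (@sphere_opp R n).
Proof.
by move=> x y; rewrite /mdist/= /sphere_dist/= dotNl dotNr opprK.
Qed.

Definition odd_fun (X Y : Type) (sX : X -> X) (sY : Y -> Y) (f : X -> Y) :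
    Prop :=
  forall x : X, f (sX x) = sY (f x).

(* Suprema and infima of distances are taken in \bar R, so that none of them
   is a default value. *)

Definition distortion (R : realType) (X Y : metricType R) (f : X -> Y) :
    \bar R :=
  ereal_sup [set (`|mdist x.1 x.2 - mdist (f x.1) (f x.2)|)%:E |
    x in [set: X * X]].

Definition diam (R : realType) (X : metricType R) (s : set X) : \bar R :=
  ereal_sup [set (mdist x.1 x.2)%:E | x in s `*` s].

Definition dist_to_set (R : realType) (Z : metricType R) (z : Z)
    (A : set Z) : \bar R :=
  ereal_inf [set (mdist z a)%:E | a in A].

Definition hausdorff_dist (R : realType) (Z : metricType R) (A B : set Z) :
    \bar R :=
  maxe (ereal_sup [set dist_to_set a B | a in A])
       (ereal_sup [set dist_to_set b A | b in B]).

Definition gh_dist (R : realType) (X Y : metricType R) : \bar R :=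
  ereal_inf [set h | exists (Z : metricType R) (g : X -> Z) (p : Y -> Z),
    [/\ isometric_embedding g, isometric_embedding p &
        h = hausdorff_dist (range g) (range p)]].

(* The geometric realization of an abstract simplicial complex with vertices
   in V and set of simplices K: a point is given by its barycentric
   coordinates, whose support is a simplex. The sum over all of V is the sum
   over this support when it is finite. *)
Record realization (R : realType) (V : choiceType) (K : set (set V)) :=
  Realization {
    bary :> V -> R ;
    bary_ge0 : forall v, 0 <= bary v ;
    bary_supp : K [set v | bary v != 0] ;
    bary_sum : \sum_(v \in [set: V]) bary v = 1
  }.

HB.instance Definition _ (R : realType) (V : choiceType) (K : set (set V)) :=
  gen_eqMixin (realization R K).
HB.instance Definition _ (R : realType) (V : choiceType) (K : set (set V)) :=
  gen_choiceMixin (realization R K).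

Section RealizationTopology.
Variables (R : realType) (V : choiceType) (K : set (set V)).

Definition closed_simplex (s : set V) : set (realization R K) :=
  [set p | [set v | p v != 0] `<=` s].

(* The usual coherent (weak) topology: U is open when its trace on each closed
   simplex is open for the Euclidean topology of that simplex, which is the
   one given by the sup distance between barycentric coordinates. *)
Definition realization_open (U : set (realization R K)) : Prop :=
  forall s, K s -> forall p, (closed_simplex s `&` U) p ->
    exists2 e : R, 0 < e & forall q, closed_simplex s q ->
      (forall v, `|p v - q v| < e) -> U q.

Lemma realization_openT : realization_open setT.
Proof. by move=> s Ks p _; exists 1. Qed.

Lemma realization_openI : setI_closed realization_open.
Proof.
move=> A B oA oB s Ks p [sp [Ap Bp]].
have [e e0 eA] := oA s Ks p (conj sp Ap).
have [d d0 dB] := oB s Ks p (conj sp Bp).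
exists (Num.min e d); first by rewrite lt_min e0.
move=> q sq pq; split; [apply: eA => // v|apply: dB => // v];
  by have := pq v; rewrite lt_min => /andP[].
Qed.

Lemma realization_open_bigU (I : Type) (f : I -> set (realization R K)) :
  (forall i, realization_open (f i)) -> realization_open (\bigcup_i f i).
Proof.
move=> of_ s Ks p [sp [i _ fip]].
have [e e0 ef] := of_ i s Ks p (conj sp fip).
by exists e => // q sq pq; exists i => //; exact: ef pq.
Qed.

HB.instance Definition _ := isOpenTopological.Build (realization R K)
  realization_openT realization_openI realization_open_bigU.

End RealizationTopology.

Definition VR_simplex (R : realType) (X : metricType R) (r : R) :
    set (set X) :=
  [set s | [/\ finite_set s, s !=set0 & (diam s <= r%:E)%E]].

Definition VR (R : realType) (X : metricType R) (r : R) :=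
  realization R (@VR_simplex R X r).

HB.instance Definition _ (R : realType) (X : metricType R) (r : R) :=
  Topological.on (@VR R X r).

(* The involution of VR(X; r) induced by an isometric involution s of X: since
   s is its own inverse, sum_i l_i (s x_i) has coordinate l (s x) at x. *)
Section VRInvolution.
Variables (R : realType) (X : metricType R) (r : R) (s : X -> X).
Hypotheses (sK : involutive s) (s_iso : isometric_embedding s).
Variable p : VR X r.

Let bary_s (x : X) : R := p (s x).

Lemma VR_inv_ge0 x : 0 <= bary_s x.
Proof. exact: bary_ge0. Qed.

Lemma VR_inv_supp : VR_simplex r [set x | bary_s x != 0].
Proof.
have [pfin [x px] pdiam] := bary_supp p.
have -> : [set x | bary_s x != 0] = s @` [set x | p x != 0].
  apply/seteqP; split => [y py|_ [y py <-]]; last by rewrite /= /bary_s sK.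
  by exists (s y); rewrite ?sK.
split; [exact: finite_image|by exists (s x), x|].
apply: le_trans pdiam; apply: ereal_sup_le => _ [[u v] /= [[a pa <-] [b pb <-]] <-].
by rewrite s_iso; exists (a, b).
Qed.

Lemma VR_inv_sum : \sum_(x \in [set: X]) bary_s x = 1.
Proof.
rewrite -(bary_sum p); apply/esym/reindex_fsbig.
by split=> // [x y _ _|y _]; [exact: (can_inj sK)|exists (s y)].
Qed.

Definition VR_inv : VR X r := Realization VR_inv_ge0 VR_inv_supp VR_inv_sum.

End VRInvolution.

Definition VR_sphere_opp (R : realType) (n : nat) (r : R) :
    VR (sphere R n) r -> VR (sphere R n) r :=
  VR_inv (@sphere_oppK R n) (@sphere_opp_isometry R n).

Definition inf_odd_distortion (R : realType) (n k : nat) : \bar R :=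
  ereal_inf [set distortion f | f in [set f : sphere R k -> sphere R n |
    odd_fun (@sphere_opp R k) (@sphere_opp R n) f]].

Definition c_ (R : realType) (n k : nat) : \bar R :=
  ereal_inf [set r%:E | r in [set r : R | 0 <= r /\
    exists2 f : sphere R k -> VR (sphere R n) r,
      continuous f & odd_fun (@sphere_opp R k) (@VR_sphere_opp R n r) f]].

(* Main.v *)
Require Import Defs.
From mathcomp Require Import all_boot all_order all_algebra.
From mathcomp Require Import all_classical all_reals all_analysis.
From mathcomp Require Import finmap lra ring.

Set Implicit Arguments.
Unset Strict Implicit.
Unset Printing Implicit Defensive.

Import Order.TTheory GRing.Theory Num.Theory.
Import numFieldNormedType.Exports.

Local Open Scope classical_set_scope.
Local Open Scope ring_scope.

(** The first inequality is the helmet trick. If S^n and S^k sit in a common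
metric space at Hausdorff distance less than t, sending each point of S^k to a
point of S^n at distance at most t from it gives a function of distortion at
most 2t, because each distance changes by at most t at either end
([hausdorff_dist_distortion]). Such a function f need not be odd, but
remembering only its values on a set that contains exactly one point of each
antipodal pair and extending these oddly does not increase the distortion: on a
sphere d(-x, y) = pi - d(x, y), so that replacing points of the source and
their images by their antipodes changes the two distances to be compared in
the same way ([odd_modification]).

For the second inequality, let f : S^k -> S^n be odd with distortion r, and let
e > 0. A finite antipodally symmetric e-net S of S^k carries a partition of
unity by bumps supported in the balls of radius e, and
  y |-> sum over x in S of weight_x(y) f(x)
takes its values in a Vietoris-Rips complex of scale r + 4e: two net points
near the same y are close together, hence so are their images, up to r. It is
odd because S and f are symmetric, and continuous because the images of all
points near y lie in one single simplex, spanned by the f(x) with x in S at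
distance less than 2e from y, on which the coherent topology is that of the
barycentric coordinates ([odd_map_VR]). Letting e tend to 0 bounds c_{n,k} by
r ([c_le_distortion]). *)

(** * Distortion and the Gromov-Hausdorff distance *)

Section Estimates.
Variable R : realType.
Implicit Types X Y Z : metricType R.

Lemma distortion_leP X Y (f : X -> Y) (r : R) :
  (distortion f <= r%:E)%E <->
  forall x x', `|mdist x x' - mdist (f x) (f x')| <= r.
Proof.
split=> [fr x x'|fr].
  rewrite -lee_fin; apply: le_trans fr.
  by apply: ereal_sup_ubound; exists (x, x').
by apply: ge_ereal_sup => _ [[x x'] _ <-]; rewrite lee_fin.
Qed.

Lemma diam_leP X (A : set X) (r : R) :
  (diam A <= r%:E)%E <-> forall x y, A x -> A y -> mdist x y <= r.
Proof.
split=> [Ar x y Ax Ay|Ar].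
  rewrite -lee_fin; apply: le_trans Ar.
  by apply: ereal_sup_ubound; exists (x, y).
by apply: ge_ereal_sup => _ [[x y] [Ax Ay] <-]; rewrite lee_fin; exact: Ar.
Qed.

(** By the triangle inequality, moving both ends of a segment by at most t
changes its length by at most 2t. *)
Lemma isometric_embedding_distortion X Y Z (g : X -> Z) (p : Y -> Z)
    (f : Y -> X) (t : R) :
  isometric_embedding g -> isometric_embedding p ->
  (forall y, mdist (p y) (g (f y)) <= t) -> (distortion f <= (2 * t)%:E)%E.
Proof.
move=> giso piso fg; apply/distortion_leP => y y'; rewrite -giso -piso.
have := metric_triangle (p y) (g (f y)) (p y').
have := metric_triangle (g (f y)) (g (f y')) (p y').
have := metric_triangle (g (f y)) (p y) (g (f y')).
have := metric_triangle (p y) (p y') (g (f y')).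
rewrite (metric_sym (g (f y')) (p y')) (metric_sym (g (f y)) (p y)).
have := fg y; have := fg y'.
move=> *; rewrite ler_norml; apply/andP; split; lra.
Qed.

Lemma hausdorff_dist_distortion X Y Z (g : X -> Z) (p : Y -> Z) (t : R) :
  isometric_embedding g -> isometric_embedding p ->
  (hausdorff_dist (range g) (range p) < t%:E)%E ->
  exists f : Y -> X, (distortion f <= (2 * t)%:E)%E.
Proof.
move=> giso piso; rewrite /hausdorff_dist gt_max => /andP[_ pgt].
have near_g y : exists x, mdist (p y) (g x) <= t.
  have : (dist_to_set (p y) (range g) < t%:E)%E.
    by apply: le_lt_trans pgt; apply: ereal_sup_ubound; exists (p y).
  move=> /ereal_inf_lt [_ [_ [x _ <-] <-]]; rewrite lte_fin => /ltW.
  by exists x.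
have [f fP] := choice near_g.
by exists f; exact: isometric_embedding_distortion fP.
Qed.

(** Embeddings of X and Y with images at Hausdorff distance less than t give a
function Y -> X of distortion at most 2t, so 2t is at least a. *)
Lemma gh_dist_ge X Y (a : \bar R) :
  (forall f : Y -> X, (a <= distortion f)%E) -> (a <= 2%:E * gh_dist X Y)%E.
Proof.
move=> af; rewrite -lee_pdivrMl//.
apply: le_ereal_inf_tmp => _ [Z [g [p [giso piso ->]]]].
rewrite lee_pdivrMl//.
set h := hausdorff_dist _ _.
have step t : (h < t%:E)%E -> (a <= (2 * t)%:E)%E.
  move=> /(hausdorff_dist_distortion giso piso) [f ft].
  exact: le_trans (af f) ft.
(* At h = -oo, where no finite slack can be added to h, arbitrarily negative
   values of t force a = -oo. *)
case: h step => [h||] step; last 2 first.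
- by rewrite gt0_muley ?lte_fin// leey.
- case: a {af} step => [r||] step; last by rewrite leNye.
    by have := step ((r - 1) / 2) (ltNyr _); rewrite lee_fin => ?; exfalso; lra.
  by have := step 0 (ltNyr _); rewrite leye_eq.
rewrite -EFinM; apply/lee_addgt0Pr => e e0; rewrite -EFinD.
have := step (h + e / 2); rewrite lte_fin ltrDl divr_gt0// => /(_ isT).
by rewrite mulrDr (mulrC _ (e / 2)) divfK.
Qed.

End Estimates.

(** * Points of a realization from finitely many weights *)

Section Pushforward.
Variables (R : realType) (T : eqType) (V : choiceType).
Variables (S : seq T) (f : T -> V).
Implicit Types w : T -> R.

(** The barycentric coordinates of the point sum_(x <- S) (w x) (f x); both f
and the list S may have repetitions, so the weights over a vertex add up. *)
Definition pushforward w (v : V) : R := \sum_(x <- S | f x == v) w x.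

Lemma pushforward_ge0 w v : (forall x, 0 <= w x) -> 0 <= pushforward w v.
Proof. by move=> w0; apply: sumr_ge0. Qed.

Lemma pushforward_supp w v : pushforward w v != 0 ->
  exists x, [/\ x \in S, w x != 0 & f x = v].
Proof.
move=> wv; apply: contrapT => nex; move/eqP: wv; apply.
rewrite /pushforward big_seq_cond big1// => x /andP[xS /eqP fx].
by apply: contrapT => /eqP wx; apply: nex; exists x.
Qed.

Lemma pushforward_sum w :
  \sum_(v \in [set: V]) pushforward w v = \sum_(x <- S) w x.
Proof.
pose r := undup (map f S).
rewrite -(@fsbig_widen _ _ _ _ [set` r])//; last first.
  move=> v /= [_ vr]; apply: contrapT => /eqP /pushforward_supp[x [xS _ fx]].
  by apply: vr; rewrite /= mem_undup -fx map_f.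
rewrite -fsbig_seq ?undup_uniq// /pushforward.
under eq_bigr do rewrite big_mkcond.
rewrite exchange_big /=; apply: eq_big_seq => x xS.
rewrite (bigD1_seq (f x)) ?mem_undup ?map_f ?undup_uniq//= eqxx.
by rewrite big1 ?addr0// => v; rewrite eq_sym => /negPf ->.
Qed.

Lemma pushforward_dist w w' v :
  `|pushforward w v - pushforward w' v| <= \sum_(x <- S) `|w x - w' x|.
Proof.
rewrite /pushforward -sumrB (le_trans (ler_norm_sum _ _ _))//.
rewrite big_mkcond /=; apply: ler_sum => x _.
by case: ifP.
Qed.

End Pushforward.

Lemma VR_simplex_near (R : realType) (X Y : metricType R) (f : X -> Y)
    (r : R) (y : X) (e : R) (A : set Y) :
  (distortion f <= r%:E)%E -> finite_set A -> A !=set0 ->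
  A `<=` f @` [set x | mdist x y < e] -> VR_simplex (r + 2 * e) A.
Proof.
move=> fr Afin A0 Ae; split => //.
apply/diam_leP => _ _ /Ae[x /= xy <-] /Ae[x' /= xy' <-].
move: fr => /distortion_leP/(_ x x'); rewrite ler_norml => /andP[+ _].
have := metric_triangle x y x'; rewrite (metric_sym y x'); lra.
Qed.

(** * The partition of unity of a finite net *)

Section PartitionOfUnity.
Variables (R : realType) (X : metricType R) (e : R) (S : seq X).
Hypothesis netS : forall y, exists2 x, x \in S & mdist x y < e.

Definition bump (x y : X) : R := Num.max 0 (e - mdist x y).
Definition mass (y : X) : R := \sum_(x <- S) bump x y.
Definition weight (y x : X) : R := bump x y / mass y.

Lemma bump_ge0 x y : 0 <= bump x y.
Proof. by rewrite le_max lexx. Qed.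

Lemma bump_gt0 x y : (0 < bump x y) = (mdist x y < e).
Proof. by rewrite lt_max ltxx subr_gt0. Qed.

Lemma mass_gt0 y : 0 < mass y.
Proof.
rewrite lt_def sumr_ge0 ?andbT; last by move=> *; exact: bump_ge0.
rewrite psumr_neq0; last by move=> *; exact: bump_ge0.
by have [x xS xy] := netS y; apply/hasP; exists x; rewrite //= bump_gt0.
Qed.

Lemma weight_ge0 y x : 0 <= weight y x.
Proof. by rewrite divr_ge0 ?bump_ge0// ltW// mass_gt0. Qed.

Lemma weight_neq0 y x : weight y x != 0 -> mdist x y < e.
Proof.
by rewrite mulf_eq0 negb_or => /andP[b0 _]; rewrite -bump_gt0 lt_def b0 bump_ge0.
Qed.

Lemma weight_sum y : \sum_(x <- S) weight y x = 1.
Proof. by rewrite -mulr_suml divff// gt_eqF// mass_gt0. Qed.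

Lemma mdist_continuous (x : X) : continuous (mdist x : X -> R).
Proof.
move=> y; apply/cvgrPdist_lt => d d0; near=> z.
have : mdist y z < d by near: z; have := near_ball y _ d0; rewrite ballEmdist.
have := metric_triangle x y z; have := metric_triangle x z y.
by rewrite (metric_sym z y) => *; rewrite ltr_norml; apply/andP; split; lra.
Unshelve. all: by end_near. Qed.

Lemma bump_continuous x : continuous (bump x).
Proof.
move=> y; apply: (@continuous_max _ _ (fun=> 0) (fun y => e - mdist x y)).
  exact: cvg_cst.
by apply: cvgB; [exact: cvg_cst|exact: mdist_continuous].
Qed.

Lemma mass_continuous : continuous mass.
Proof.
apply: continuous_big => [|x _]; [exact: add_continuous|exact: bump_continuous].
Qed.

Lemma weight_continuous x : continuous (weight ^~ x).
Proof.
move=> y; apply: cvgM; first exact: bump_continuous.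
by apply: cvgV; [rewrite gt_eqF// mass_gt0|exact: mass_continuous].
Qed.

Lemma weight_dist_cvg0 y :
  \sum_(x <- S) `|weight y x - weight y' x| @[y' --> y] --> (0 : R).
Proof.
have sum0 : \sum_(x <- S) `|weight y x - weight y x| = 0.
  by rewrite big1// => x _; rewrite subrr normr0.
rewrite -[X in _ --> X]sum0.
apply: (@cvg_big _ _ +%R 0 xpredT add_continuous _ (nbhs y) S
  (fun x y' => `|weight y x - weight y' x|)) => x _.
by apply: cvg_norm; apply: cvgB; [exact: cvg_cst|exact: weight_continuous].
Qed.

End PartitionOfUnity.

(** * An odd map into a Vietoris-Rips complex *)

Lemma realization_eq (R : realType) (V : choiceType) (K : set (set V))
  (p q : realization R K) : p =1 q -> p = q.
Proof.
case: p q => [p p0 ps p1] [q q0 qs q1] /= /funext pq.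
by subst q; congr Realization; exact: Prop_irrelevance.
Qed.

Section OddMap.
Variables (R : realType) (X Y : metricType R) (sX : X -> X) (sY : Y -> Y).
Hypotheses (sXK : involutive sX) (sX_iso : isometric_embedding sX).
Hypotheses (sYK : involutive sY) (sY_iso : isometric_embedding sY).
Variables (f : X -> Y) (r e : R) (s : seq X).
Hypothesis e_gt0 : 0 < e.
Hypothesis f_odd : odd_fun sX sY f.
Hypothesis fr : (distortion f <= r%:E)%E.
Hypothesis net : forall y, exists2 x, x \in s & mdist x y < e.

(* Listing a point twice, as happens when s already contains its antipode, only
   doubles its bump; the list is symmetric as a multiset whatever s is. *)
Let S := s ++ map sX s.

Let netS y : exists2 x, x \in S & mdist x y < e.
Proof. by have [x xs xy] := net y; exists x; rewrite // mem_cat xs. Qed.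

Let coord (y : X) : Y -> R := pushforward S f (weight e S y).

Let coord_supp y y' d : e + mdist y' y <= d ->
  [set v | coord y' v != 0] `<=` f @` ([set` S] `&` [set x | mdist x y < d]).
Proof.
move=> yd v /pushforward_supp[x [xS /weight_neq0 xy <-]].
exists x => //; split => //=.
by have := metric_triangle x y' y; lra.
Qed.

Let coord_sum y : \sum_(v \in [set: Y]) coord y v = 1.
Proof. by rewrite pushforward_sum weight_sum. Qed.

(* The radius is 2e rather than e so that this simplex contains the supports of
   the coordinates at all points of the ball of radius e around y. *)
Let star_simplex y :
  VR_simplex (r + 4 * e) (f @` ([set` S] `&` [set x | mdist x y < 2 * e])).
Proof.
rewrite (_ : 4 * e = 2 * (2 * e)); last lra.
apply: (VR_simplex_near fr (y := y)); last first.
- by apply: image_subset => x [].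
- have [x xS xy] := netS y; exists (f x), x => //; split => //=.
  by move: e_gt0 xy; lra.
- by apply: finite_image; apply: finite_setIl.
Qed.

Let coord_simplex y : VR_simplex (r + 4 * e) [set v | coord y v != 0].
Proof.
have [fin _ dia] := star_simplex y.
have sub : [set v | coord y v != 0] `<=`
    f @` ([set` S] `&` [set x | mdist x y < 2 * e]).
  by apply: coord_supp; rewrite mdistxx; move: e_gt0; lra.
split; first exact: sub_finite_set fin.
  apply: contrapT => c0; have := coord_sum y.
  rewrite fsbig1 => [/esym/eqP|v _]; first by rewrite oner_eq0.
  by apply: contrapT => /eqP cv; apply: c0; exists v.
by apply/diam_leP => u v /sub ? /sub ?; move/diam_leP : dia; exact.
Qed.

Let F (y : X) : VR Y (r + 4 * e) :=
  Realization (fun v => pushforward_ge0 S f v (weight_ge0 netS y))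
    (coord_simplex y) (coord_sum y).

Let F_continuous : continuous F.
Proof.
move=> y N; rewrite nbhsE => -[U [oU Uy] UN].
have Fy : closed_simplex
    (f @` ([set` S] `&` [set x | mdist x y < 2 * e])) (F y).
  by apply: (@coord_supp y y); rewrite mdistxx; move: e_gt0; lra.
(* Openness of U is used on the star simplex of y alone; the images of the
   points at distance less than e from y all lie on it. *)
have [d d0 dU] := oU _ (star_simplex y) (F y) (conj Fy Uy).
have near_coord : \forall y' \near y,
    \sum_(x <- S) `|weight e S y x - weight e S y' x| < d.
  have /cvgrPdist_lt/(_ d d0) := weight_dist_cvg0 netS y.
  by apply: filterS => y'; rewrite sub0r normrN; apply: le_lt_trans (ler_norm _).
have near_y : \forall y' \near y, mdist y y' < e.
  by have := near_ball y _ e_gt0; rewrite ballEmdist.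
suff : \forall y' \near y, N (F y') by [].
near=> y'; apply: UN; apply: dU => [|v].
  apply: (@coord_supp y y'); rewrite metric_sym.
  have : mdist y y' < e by near: y'.
  lra.
by apply: le_lt_trans (pushforward_dist _ _ _ _ _) _; near: y'.
Unshelve. all: by end_near. Qed.

Let sum_S_sym (P : pred X) (G : X -> R) :
  \sum_(x <- S | P x) G x = \sum_(x <- S | P (sX x)) G (sX x).
Proof.
rewrite /S !big_cat !big_map /= addrC; congr (_ + _).
by apply: eq_big => x; rewrite sXK.
Qed.

Let weight_sX y x : weight e S (sX y) (sX x) = weight e S y x.
Proof.
rewrite /weight /mass sum_S_sym /bump sX_iso; congr (_ / _).
by apply: eq_bigr => z _; rewrite sX_iso.
Qed.

Let F_odd : odd_fun sX (VR_inv sYK sY_iso) F.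
Proof.
move=> y; apply: realization_eq => v /=; rewrite /coord /pushforward sum_S_sym.
apply: eq_big => x; last by rewrite weight_sX.
by rewrite f_odd (can2_eq sYK sYK).
Qed.

(** Nearby points of X are sent into the simplex spanned by the images of net
points at mutual distance less than 4e, and f stretches distances by at most r;
this gives the scale r + 4e, whether or not f is continuous. *)
Lemma odd_map_VR : exists2 F : X -> VR Y (r + 4 * e),
  continuous F & odd_fun sX (VR_inv sYK sY_iso) F.
Proof. by exists F. Qed.

End OddMap.

(** * Spheres *)

Section Spheres.
Variable R : realType.

Lemma sphere_distNl n (x y : sphere R n) :
  mdist (sphere_opp x) y = pi - mdist x y.
Proof. by rewrite /mdist/= /sphere_dist dotNl acosN// sphere_dotB. Qed.

Lemma sphere_distNr n (x y : sphere R n) :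
  mdist x (sphere_opp y) = pi - mdist x y.
Proof. by rewrite metric_sym sphere_distNl metric_sym. Qed.

Lemma sphere_opp_neq n (x : sphere R n) : sphere_opp x != x.
Proof.
apply/eqP => xN; have := sphere_distNl x x.
by rewrite xN mdistxx subr0 => /esym/eqP; rewrite gt_eqF// pi_gt0.
Qed.

(** The helmet: a set containing exactly one point of each antipodal pair, here
the chosen representative of the pair. *)
Lemma sphere_half n : exists h : sphere R n -> bool,
  forall x, h (sphere_opp x) = ~~ h x.
Proof.
pose P (x : sphere R n) := [pred y | (y == x) || (y == sphere_opp x)].
have PN x : P (sphere_opp x) =1 P x by move=> y; rewrite /= sphere_oppK orbC.
pose rep x := choose (P x) x.
(* The choice depends on the predicate P x only, up to extensional equality, and
   not on x itself. *)
have repN x : rep (sphere_opp x) = rep x.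
  rewrite /rep (eq_choose (PN x)); apply: choose_id => /=.
    by rewrite eqxx orbT.
  by rewrite eqxx.
have repP x : rep x = x \/ rep x = sphere_opp x.
  have : P x (rep x) by apply: chooseP; rewrite /= eqxx.
  by move=> /orP[] /eqP; [left|right].
exists (fun x => rep x == x) => x; rewrite repN.
case: (repP x) => ->; first by rewrite eqxx eq_sym; exact/negbTE/sphere_opp_neq.
by rewrite eqxx sphere_opp_neq.
Qed.

(** For x and y in the helmet, d(x, y) and d(f x, f y) become pi - d(x, y) and
pi - d(f x, f y) when one of x, y is replaced by its antipode, and are unchanged
when both are; so g has no distortion that f does not have on the helmet. *)
Lemma odd_modification n k (f : sphere R k -> sphere R n) :
  exists2 g : sphere R k -> sphere R n,
    odd_fun (@sphere_opp R k) (@sphere_opp R n) g &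
    (distortion g <= distortion f)%E.
Proof.
have [h hN] := sphere_half k.
exists (fun x => if h x then f x else sphere_opp (f (sphere_opp x))).
  by move=> x; rewrite hN; case: (h x); rewrite /= !sphere_oppK.
apply: ge_ereal_sup => _ [[x y] _ <-] /=.
pose x' := if h x then x else sphere_opp x.
pose y' := if h y then y else sphere_opp y.
apply: ereal_sup_ubound; exists (x', y') => //=; congr (_%:E).
rewrite /x' /y'; case: (h x); case: (h y) => //.
- by rewrite !sphere_distNr -normrN; congr (`|_|); ring.
- by rewrite !sphere_distNl -normrN; congr (`|_|); ring.
- by rewrite !sphere_opp_isometry.
Qed.

Lemma sphere_nonempty n : [set: sphere R n] !=set0.
Proof.
have e0 : enorm (delta_mx 0 0 : 'rV[R]_n.+1) == 1.
  rewrite /enorm /dot (bigD1 ord0)//= big1 => [|i /negPf i0].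
    by rewrite !mxE !eqxx mulr1 addr0 sqrtr1.
  by rewrite !mxE i0 andbF mulr0.
by exists (Sphere e0).
Qed.

Lemma dot_continuous m (v : 'rV[R]_m) : continuous (fun u => dot u v).
Proof.
apply: continuous_big => [|i _]; first exact: add_continuous.
by move=> u; apply: continuousM; [exact: coord_continuous|exact: cst_continuous].
Qed.

Lemma dotxx_continuous m : continuous (fun u : 'rV[R]_m => dot u u).
Proof.
apply: continuous_big => [|i _]; first exact: add_continuous.
by move=> u; apply: continuousM; exact: coord_continuous.
Qed.

(** Compactness is taken from the ambient vector space, where bounded closed sets
are compact; the spheres themselves carry the topology of the arccosine
metric. *)
Lemma unit_vectors_compact n : compact [set u : 'rV[R]_n.+1 | dot u u = 1].
Proof.
apply: bounded_closed_compact.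
  exists 1; split; first exact: num_real.
  move=> M M1 u /= u1; rewrite /Num.Def.normr /= mx_normrE.
  apply: bigmax_le => [|[i j] _ /=]; first by rewrite ltW// (lt_trans ltr01).
  apply: le_trans (ltW M1); rewrite -[leRHS]normr1 -ler_sqr ?nnegrE ?normr_ge0//.
  rewrite !real_normK ?num_real// expr1n -u1 /dot (bigD1 j)//= (ord1 i) -expr2.
  by rewrite lerDl; apply: sumr_ge0 => l _; rewrite -expr2 sqr_ge0.
rewrite (_ : [set u | _] = (fun u : 'rV[R]_n.+1 => dot u u) @^-1` [set 1]) //.
apply: closed_comp; first by move=> u _; exact: dotxx_continuous.
exact: closed_eq.
Qed.

(** A finite subcover of the unit vectors by the open caps of vectors u with
cos d < dot u x; on unit vectors these are the geodesic balls of radius d. *)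
Lemma sphere_totally_bounded n (e : R) : 0 < e ->
  exists s : seq (sphere R n), forall y, exists2 x, x \in s & mdist x y < e.
Proof.
move=> e0.
(* The radius is cut off at pi, as cos is decreasing on [0, pi] only. *)
pose d := Num.min e pi.
have d0 : 0 < d by rewrite lt_min e0 pi_gt0.
have dpi : d <= pi by rewrite ge_min lexx orbT.
have := @unit_vectors_compact n.
rewrite compact_cover => /(_ (sphere R n) setT
  (fun x => [set u : 'rV[R]_n.+1 | cos d < dot u x])).
case.
- move=> x _; apply: (@open_comp _ _ (fun u => dot u x) [set t | cos d < t]).
    by move=> u _; exact: dot_continuous.
  exact: open_gt.
- move=> u /= u1; have su : enorm u == 1 by rewrite /enorm u1 sqrtr1.
  exists (Sphere su) => //=.
  by rewrite u1 -cos0 ltr_cos // in_itv/= ?lexx ?pi_ge0 ?dpi ?(ltW d0).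
move=> D _ cov; exists (enum_fset D) => y.
have [x xD /= xy] := cov y (sphere_dot y).
exists x => //; rewrite metric_sym.
suff : mdist y x < d by rewrite lt_min => /andP[].
have yx := sphere_dotB y x.
rewrite -ltr_cos ?in_itv /mdist/= /sphere_dist ?acosK ?in_itv//.
  by rewrite acos_ge0 ?acos_lepi.
by rewrite dpi ltW.
Qed.

Lemma c_le_distortion n k (f : sphere R k -> sphere R n) :
  odd_fun (@sphere_opp R k) (@sphere_opp R n) f ->
  (c_ R n k <= distortion f)%E.
Proof.
move=> f_odd; have [x0 _] := sphere_nonempty k.
have dis0 : (0 <= distortion f)%E.
  apply: le_trans (ereal_sup_ubound _); last by exists (x0, x0).
  by rewrite lee_fin normr_ge0.
case dis : (distortion f) dis0 => [r||] // r0; last by rewrite leey.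
rewrite lee_fin in r0.
(* c_ is an infimum: each scale r + e > r admits an odd map. *)
apply/lee_addgt0Pr => e e0; rewrite -EFinD.
have e4 : 0 < e / 4 by rewrite divr_gt0.
have [s net] := sphere_totally_bounded k e4.
have fr : (distortion f <= r%:E)%E by rewrite dis.
have [F Fc Fo] := odd_map_VR (@sphere_oppK R k) (@sphere_opp_isometry R k)
  (@sphere_oppK R n) (@sphere_opp_isometry R n) e4 f_odd fr net.
rewrite -(divfK (_ : 4 != 0 :> R) e)// (mulrC _ 4).
apply: ereal_inf_lbound; exists (r + 4 * (e / 4)) => //; split; last by exists F.
by rewrite addr_ge0// mulr_ge0// ltW.
Qed.

End Spheres.

Theorem mainTheorem1 (R : realType) (n k : nat) (hnk : (n <= k)%N) :
  (inf_odd_distortion R n k <= 2%:E * gh_dist (sphere R n) (sphere R k))%E /\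
  (c_ R n k <= inf_odd_distortion R n k)%E.
Proof.
split.
  apply: gh_dist_ge => f; have [g g_odd gf] := odd_modification f.
  by apply: le_trans gf; apply: ereal_inf_lbound; exists g.
by apply: le_ereal_inf_tmp => _ [f f_odd <-]; exact: c_le_distortion.
Qed.
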